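(* Let $f:\mathbb R^n\to(-\infty,+\infty]$ and $g:\mathbb R^m\to(-\infty,+\infty]$ be proper lower semicontinuous convex functions and let $A\in\mathbb R^{m\times n}$. Consider the problem $\min_xf(x)+g(Ax)$ and its primal-dual formulation $\min_{x\in\mathbb R^n}\max_{y\in\mathbb R^m}f(x)+\langle Ax,y\rangle-g^*(y)$, and assume the latter has an optimal solution $(v_*,y_* )$. Let $\tau>0$, $\lambda>\tau\|A\|^2$, $\mathcal P=\begin{pmatrix}\frac1\tau I&-A^T\\-A&\lambda I\end{pmatrix}$, and let $\{(v_k,y_k)\}_{k=0}^\infty$ be the iterates of linearized ADMM with parameters $\lambda,\tau$. Then for every $k\ge1$: (i) $\mathrm{dist}^2_{\mathcal P^{-1}}(0,\mathcal F(v_{k+1},y_{k+1}))\le\mathrm{dist}^2_{\mathcal P^{-1}}(0,\mathcal F(v_k,y_k))$. (ii) $\mathrm{dist}^2_{\mathcal P^{-1}}(0,\mathcal F(v_k,y_k))\le\frac1k\|(v_0,y_0)-(v_*,y_* )\|_{\mathcal P}^2$. (iii) Assume furthermore that there are a constant $\alpha_{\mathcal P}>0$ and a set $\mathbb S\subseteq\mathbb R^{n+m}$ containing $\{(v_k,y_k)\}_{k=0}^\infty$ such that $\alpha_{\mathcal P}\,\mathrm{dist}_{\mathcal P}((v,y),\mathcal F^{-1}(0))\le\mathrm{dist}_{\mathcal P^{-1}}(0,\mathcal F(v,y))$ for all $(v,y)\in\mathbb S$. Then for every $k\ge\lceil e/\alpha_{\mathcal P}^2\rceil$, $$\mathrm{dist}^2_{\mathcal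 P^{-1}}(0,\mathcal F(v_k,y_k))\le\exp\left(1-\frac k{\lceil e/\alpha_{\mathcal P}^2\rceil}\right)\mathrm{dist}^2_{\mathcal P^{-1}}(0,\mathcal F(v_0,y_0)).$$
   Context: $f^*,g^*$ are the convex (Fenchel) conjugates; $\|A\|$ is the operator norm; $e$ is Euler's number. Linearized ADMM, from initial $v_0,w_0\in\mathbb R^n$, $y_0\in\mathbb R^m$, iterates for $k=0,1,\dots$: $$w_{k+1}=\mathrm{argmin}_w\{f^*(w)-\langle w,v_k-\tau(A^Ty_k+w_k)\rangle+\tfrac\tau2\|w-w_k\|_2^2\},$$ $$v_{k+1}=v_k-\tau(A^Ty_k+w_{k+1}),$$ $$y_{k+1}=\mathrm{argmin}_y\{g^*(y)-\langle A^Ty,v_{k+1}-\tau(A^Ty_k+w_{k+1})\rangle+\tfrac\lambda2\|y-y_k\|_2^2\}.$$ $\mathcal F(v,y)=\begin{pmatrix}\partial f(v)+A^Ty\\\partial g^*(y)-Av\end{pmatrix}$ with $\partial$ the convex subdifferential, and $\mathcal F^{-1}(0)=\{(v,y):0\in\mathcal F(v,y)\}$; an optimal solution of the primal-dual problem is an element of $\mathcal F^{-1}(0)$. $\mathcal P$ is positive definite under the stated assumption. For positive definite $M$, $\|u\|_M=\sqrt{u^TMu}$ and $\mathrm{dist}_M(z,\mathcal S)=\inf_{u\in\mathcal S}\|u-z\|_M$ (equal to $+\infty$ if $\mathcal S=\emptyset$). *)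

(* Defs.v *)
From HB Require Import structures.
From mathcomp Require Export all_boot all_order all_algebra.
From mathcomp Require Export all_classical all_reals all_analysis.
Export Order.TTheory GRing.Theory Num.Theory.
Export numFieldNormedType.Exports.

Set Implicit Arguments.
Unset Strict Implicit.
Unset Printing Implicit Defensive.

Local Open Scope classical_set_scope.
Local Open Scope ring_scope.

Definition dot (R : realType) (n : nat) (u v : 'cV[R]_n) : R :=
  (u^T *m v) 0 0.

(* The Euclidean norm; the library's norm on matrices is the sup norm. *)
Definition norm2 (R : realType) (n : nat) (u : 'cV[R]_n) : R :=
  Num.sqrt (dot u u).

Definition opnorm (R : realType) (m n : nat) (A : 'M[R]_(m, n)) : R :=
  sup [set norm2 (A *m x) | x in [set x : 'cV[R]_n | norm2 x <= 1]].

Definition normM (R : realType) (n : nat) (M : 'M[R]_n) (u : 'cV[R]_n) : R :=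
  Num.sqrt ((u^T *m M *m u) 0 0).

(* Extended-real valued, so that the distance to the empty set is +oo. *)
Definition distM (R : realType) (n : nat) (M : 'M[R]_n) (z : 'cV[R]_n)
    (S : set 'cV[R]_n) : \bar R :=
  ereal_inf [set (normM M (u - z))%:E | u in S].

Definition proper_efun (R : realType) (n : nat) (h : 'cV[R]_n -> \bar R) : Prop :=
  (forall x, h x != -oo%E) /\ (exists x, h x != +oo%E).

(* Only meaningful when h avoids -oo; recall that 0 * +oo = 0 in \bar R. *)
Definition convex_efun (R : realType) (n : nat) (h : 'cV[R]_n -> \bar R) :
    Prop :=
  forall (x y : 'cV[R]_n) (t : R), 0 <= t <= 1 ->
    (h (t *: x + (1 - t) *: y)%R <= t%:E * h x + (1 - t)%:E * h y)%E.

Definition conjugate (R : realType) (n : nat) (h : 'cV[R]_n -> \bar R)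
    (w : 'cV[R]_n) : \bar R :=
  ereal_sup [set ((dot w x)%:E - h x)%E | x in [set: 'cV[R]_n]].

(* For proper h this set is empty at every x with h x = +oo, as usual. *)
Definition subdiff (R : realType) (n : nat) (h : 'cV[R]_n -> \bar R)
    (x : 'cV[R]_n) : set 'cV[R]_n :=
  [set u | forall z, (h x + (dot u (z - x)%R)%:E <= h z)%E].

Definition argmin (R : realType) (n : nat) (h : 'cV[R]_n -> \bar R) :
    set 'cV[R]_n :=
  [set x | forall z, (h x <= h z)%E].

(* The pair (v, y) in R^n x R^m is the stacked vector col_mx v y. *)
Definition KKT (R : realType) (m n : nat) (f : 'cV[R]_n -> \bar R)
    (g : 'cV[R]_m -> \bar R) (A : 'M[R]_(m, n)) (v : 'cV[R]_n)
    (y : 'cV[R]_m) : set 'cV[R]_(n + m) :=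
  [set col_mx (a + A^T *m y) (b - A *m v) |
    a in subdiff f v & b in subdiff (conjugate g) y].

Definition KKT_zeros (R : realType) (m n : nat) (f : 'cV[R]_n -> \bar R)
    (g : 'cV[R]_m -> \bar R) (A : 'M[R]_(m, n)) : set 'cV[R]_(n + m) :=
  [set z | KKT f g A (usubmx z) (dsubmx z) 0].

Definition Pmx (R : realType) (m n : nat) (A : 'M[R]_(m, n))
    (tau lambda : R) : 'M[R]_(n + m) :=
  block_mx (tau^-1)%:M (- A^T) (- A) lambda%:M.

(* Both objectives are strongly convex, so membership in the argmin
   determines the next iterate. *)
Definition linearized_ADMM (R : realType) (m n : nat)
    (f : 'cV[R]_n -> \bar R) (g : 'cV[R]_m -> \bar R) (A : 'M[R]_(m, n))
    (tau lambda : R) (v w : nat -> 'cV[R]_n) (y : nat -> 'cV[R]_m) : Prop :=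
  forall k : nat,
    [/\ argmin (fun w' => conjugate f w'
            - (dot w' (v k - tau *: (A^T *m y k + w k))%R)%:E
            + (tau / 2 * norm2 (w' - w k) ^+ 2)%R%:E)%E (w k.+1),
        v k.+1 = v k - tau *: (A^T *m y k + w k.+1)
      & argmin (fun y' => conjugate g y'
            - (dot (A^T *m y')
                   (v k.+1 - tau *: (A^T *m y k + w k.+1))%R)%:E
            + (lambda / 2 * norm2 (y' - y k) ^+ 2)%R%:E)%E (y k.+1)].

(* Main.v *)
Require Import Defs.
From mathcomp Require Import all_boot all_order all_algebra.
From mathcomp Require Import all_classical all_reals all_analysis.
From mathcomp Require Import ring lra.

(** In the metric of P, linearized ADMM is the proximal point method for the
    monotone operator F: the optimality conditions of the two subproblems say
    that P (z_k - z_{k+1}) belongs to F z_{k+1}.  Hence dist(0, F z_{k+1}) is at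
    most the step length |z_k - z_{k+1}|_P, which by monotonicity is at most
    dist(0, F z_k); this is (i).  Testing monotonicity against a zero z* gives
    |z_{k+1} - z*|^2 + |z_k - z_{k+1}|^2 <= |z_k - z*|^2, and summing yields (ii).
    Applying (ii) to K = ceil(e / alpha^2) consecutive steps and taking the
    infimum over z*, metric subregularity makes dist^2(0, F z_k) shrink by the
    factor 1 / (K alpha^2) <= 1/e over every K steps, which is (iii). *)

Local Open Scope classical_set_scope.
Local Open Scope ring_scope.

(** * Euclidean inner product, operator norm, and positive definiteness of [Pmx] *)

Section Dot.
Set Implicit Arguments.
Unset Strict Implicit.
Context {R : realType}.
Implicit Types n m : nat.

Lemma dotE n (u v : 'cV[R]_n) : dot u v = \sum_i u i 0 * v i 0.
Proof. by rewrite /dot !mxE; apply: eq_bigr => i _; rewrite mxE. Qed.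

Lemma dotC n (u v : 'cV[R]_n) : dot u v = dot v u.
Proof. by rewrite !dotE; apply: eq_bigr => i _; rewrite mulrC. Qed.

Lemma dotDl n (u v w : 'cV[R]_n) : dot (u + v) w = dot u w + dot v w.
Proof. by rewrite /dot linearD mulmxDl mxE. Qed.

Lemma dotDr n (u v w : 'cV[R]_n) : dot w (u + v) = dot w u + dot w v.
Proof. by rewrite /dot mulmxDr mxE. Qed.

Lemma dotNl n (u v : 'cV[R]_n) : dot (- u) v = - dot u v.
Proof. by rewrite /dot linearN mulNmx mxE. Qed.

Lemma dotNr n (u v : 'cV[R]_n) : dot u (- v) = - dot u v.
Proof. by rewrite /dot mulmxN mxE. Qed.

Lemma dotZl n a (u v : 'cV[R]_n) : dot (a *: u) v = a * dot u v.
Proof. by rewrite /dot linearZ /= -scalemxAl mxE. Qed.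

Lemma dotZr n a (u v : 'cV[R]_n) : dot u (a *: v) = a * dot u v.
Proof. by rewrite /dot -scalemxAr mxE. Qed.

Lemma dot0l n (u : 'cV[R]_n) : dot 0 u = 0.
Proof. by rewrite /dot trmx0 mul0mx mxE. Qed.

Lemma dot0r n (u : 'cV[R]_n) : dot u 0 = 0.
Proof. by rewrite dotC dot0l. Qed.

Definition dot_lin := (dotDl, dotDr, dotNl, dotNr, dotZl, dotZr, dot0l, dot0r).

Lemma dot_mulmxl m n (A : 'M[R]_(m, n)) u v : dot (A *m u) v = dot u (A^T *m v).
Proof. by rewrite /dot trmx_mul mulmxA. Qed.

Lemma dot_col_mx m n (a c : 'cV[R]_m) (b d : 'cV[R]_n) :
  dot (col_mx a b) (col_mx c d) = dot a c + dot b d.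
Proof. by rewrite /dot tr_col_mx mul_row_col mxE. Qed.

Lemma dotuu_ge0 n (u : 'cV[R]_n) : 0 <= dot u u.
Proof. by rewrite dotE; apply: sumr_ge0 => i _; rewrite -expr2 sqr_ge0. Qed.

Lemma dotuu_eq0 n (u : 'cV[R]_n) : dot u u = 0 -> u = 0.
Proof.
rewrite dotE => /eqP; rewrite psumr_eq0; last by move=> i _; rewrite -expr2 sqr_ge0.
move=> /allP u0; apply/colP => i; rewrite mxE; apply/eqP.
by have := u0 i (mem_index_enum i); rewrite /= -expr2 sqrf_eq0.
Qed.

Lemma norm2_ge0 n (u : 'cV[R]_n) : 0 <= norm2 u.
Proof. exact: sqrtr_ge0. Qed.

Lemma sqr_norm2 n (u : 'cV[R]_n) : norm2 u ^+ 2 = dot u u.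
Proof. by rewrite sqr_sqrtr // dotuu_ge0. Qed.

Lemma norm2_eq0 n (u : 'cV[R]_n) : norm2 u = 0 -> u = 0.
Proof. by move=> u0; apply: dotuu_eq0; rewrite -sqr_norm2 u0 expr0n. Qed.

Lemma norm20 n : norm2 (0 : 'cV[R]_n) = 0.
Proof. by rewrite /norm2 dot0l sqrtr0. Qed.

Lemma norm2Z n a (u : 'cV[R]_n) : norm2 (a *: u) = `|a| * norm2 u.
Proof. by rewrite /norm2 !dot_lin mulrA -expr2 sqrtrM ?sqr_ge0 // sqrtr_sqr. Qed.

(** Cauchy-Schwarz: expand the square of [norm2 v *: u - norm2 u *: v] and divide by
    [norm2 u * norm2 v], the zero cases apart. *)
Lemma dot_le_norm2 n (u v : 'cV[R]_n) : dot u v <= norm2 u * norm2 v.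
Proof.
have [u0|u0] := eqVneq (norm2 u) 0; first by rewrite (norm2_eq0 u0) norm20 dot0l mul0r.
have [v0|v0] := eqVneq (norm2 v) 0; first by rewrite (norm2_eq0 v0) norm20 dot0r mulr0.
have uv : 0 < norm2 u * norm2 v by rewrite mulr_gt0 // lt0r norm2_ge0 ?u0 ?v0.
have := dotuu_ge0 (norm2 v *: u - norm2 u *: v).
rewrite !dot_lin (dotC v u) -!sqr_norm2 => H.
rewrite -(ler_pM2l uv); nra.
Qed.

(** The real [sup] in [opnorm] is an upper bound only if its set is bounded; the Frobenius norm of
    [A] serves as the bound. *)
Lemma norm2_mulmx_bounded m n (A : 'M[R]_(m, n)) :
  exists C, forall x, norm2 x <= 1 -> norm2 (A *m x) <= C.
Proof.
exists (Num.sqrt (\sum_i norm2 (row i A)^T ^+ 2)) => x x1.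
rewrite ler_wsqrtr // dotE ler_sum // => i _.
rewrite -expr2.
have -> : (A *m x) i 0 = dot (row i A)^T x.
  by rewrite dotE mxE; apply: eq_bigr => j _; rewrite !mxE.
have a0 := norm2_ge0 (row i A)^T.
have := dot_le_norm2 (row i A)^T x.
have := dot_le_norm2 (- (row i A)^T) x.
rewrite -scaleN1r norm2Z normrN1 mul1r dotZl => H1 H2.
have x0 := norm2_ge0 x.
rewrite -real_normK ?num_real // lerXn2r ?nnegrE //.
rewrite ler_norml; apply/andP; split; nra.
Qed.

Lemma opnorm_ge0 m n (A : 'M[R]_(m, n)) : 0 <= opnorm A.
Proof.
have [C HC] := norm2_mulmx_bounded A.
apply: le_trans (norm2_ge0 (A *m 0)) _.
apply: ub_le_sup; last by exists 0 => //=; rewrite norm20.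
by exists C => _ [x /= x1 <-]; exact: HC.
Qed.

Lemma norm2_mulmx_le m n (A : 'M[R]_(m, n)) x : norm2 (A *m x) <= opnorm A * norm2 x.
Proof.
have [x0|x0] := eqVneq (norm2 x) 0.
  by rewrite (norm2_eq0 x0) mulmx0 !norm20 mulr0.
have xp : 0 < norm2 x by rewrite lt0r norm2_ge0 x0.
rewrite -ler_pdivrMr // mulrC -[(norm2 x)^-1]ger0_norm ?invr_ge0 ?norm2_ge0 //.
rewrite -norm2Z scalemxAr.
have [C HC] := norm2_mulmx_bounded A.
apply: ub_le_sup; first by exists C => _ [z /= z1 <-]; exact: HC.
exists ((norm2 x)^-1 *: x) => //=.
by rewrite norm2Z ger0_norm ?invr_ge0 ?norm2_ge0 // mulVf.
Qed.

Lemma Pmx_sym m n (A : 'M[R]_(m, n)) tau lambda : (Pmx A tau lambda)^T = Pmx A tau lambda.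
Proof. by rewrite /Pmx tr_block_mx !tr_scalar_mx !linearN /= trmxK. Qed.

Lemma Pmx_posdef m n (A : 'M[R]_(m, n)) tau lambda (u : 'cV[R]_(n + m)) :
  0 < tau -> tau * opnorm A ^+ 2 < lambda -> u != 0 ->
  0 < dot u (Pmx A tau lambda *m u).
Proof.
move=> tau0 lam u0; rewrite -(vsubmxK u).
set v := usubmx u; set y := dsubmx u.
rewrite /Pmx mul_block_col !mul_scalar_mx dot_col_mx !mulNmx !dot_lin.
rewrite -dot_mulmxl (dotC y) -!sqr_norm2.
have H1 := le_trans (dot_le_norm2 (A *m v) y) (ler_wpM2r (norm2_ge0 y) (norm2_mulmx_le A v)).
have L0 := opnorm_ge0 A; have a0 := norm2_ge0 v; have b0 := norm2_ge0 y.
have uvy : norm2 v != 0 \/ norm2 y != 0.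
  have [v0|] := eqVneq (norm2 v) 0; last by left.
  have [y0|] := eqVneq (norm2 y) 0; last by right.
  by case/eqP: u0; rewrite -(vsubmxK u) -/v -/y (norm2_eq0 v0) (norm2_eq0 y0) col_mx0.
move: (dot _ _) (norm2 v) (norm2 y) (opnorm A) H1 L0 a0 b0 uvy lam.
move=> d a b L H1 L0 a0 b0 uvy lam.
suff : 0 < tau^-1 * a ^+ 2 + lambda * b ^+ 2 - 2 * (L * a * b) by lra.
(* Completing the square in [a]; by [lam] the remaining coefficient of [b ^+ 2] is positive. *)
have -> : tau^-1 * a ^+ 2 + lambda * b ^+ 2 - 2 * (L * a * b)
  = tau^-1 * (a - tau * L * b) ^+ 2 + (lambda - tau * L ^+ 2) * b ^+ 2.
  by field; rewrite gt_eqF.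
have ti : 0 < tau^-1 by rewrite invr_gt0.
have [b1|b1] := eqVneq b 0.
  subst b; rewrite mulr0 subr0 expr0n mulr0 addr0 mulr_gt0 // exprn_gt0 //.
  by case: uvy => [|/eqP//]; rewrite lt0r a0 andbT.
apply: ltr_wpDl; first by rewrite mulr_ge0 ?sqr_ge0 // ltW.
by rewrite mulr_gt0 ?subr_gt0 // exprn_gt0 // lt0r b1.
Qed.

End Dot.

(** * Norms of a positive definite matrix and of its inverse *)

Section PositiveDefinite.
Set Implicit Arguments.
Unset Strict Implicit.
Context {R : realType} {n : nat} (P : 'M[R]_n).
Hypothesis P_sym : P^T = P.
Hypothesis P_pos : forall u, u != 0 -> 0 < dot u (P *m u).

Lemma posdef_ge0 u : 0 <= dot u (P *m u).
Proof.
by have [->|/P_pos/ltW//] := eqVneq u 0; rewrite dot0l.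
Qed.

Lemma posdef_unit : P \in unitmx.
Proof.
rewrite unitmxE unitfE; apply/det0P => -[u u0 uP].
have : u^T != 0 by apply: contraNneq u0 => /(congr1 trmx); rewrite trmxK trmx0 => ->.
by move=> /P_pos; rewrite -P_sym -trmx_mul uP trmx0 dot0r ltxx.
Qed.

Lemma dot_symM u w : dot u (P *m w) = dot w (P *m u).
Proof. by rewrite dotC dot_mulmxl P_sym. Qed.

Lemma sqr_normM u : normM P u ^+ 2 = dot u (P *m u).
Proof.
by rewrite /normM -mulmxA sqr_sqrtr // -/(dot u (P *m u)) posdef_ge0.
Qed.

Lemma normM_invmx p : normM (invmx P) p = normM P (invmx P *m p).
Proof.
rewrite /normM -!mulmxA mulKVmx ?posdef_unit //.
by rewrite trmx_mul trmx_inv P_sym -mulmxA.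
Qed.

(** The squared [P]-norm of [invmx P *m p - d] is nonnegative, and its cross term is
    [- 2 * dot p d]. *)
Lemma normM_invmx_ge d p :
  dot d (P *m d) <= dot p d -> normM P d <= normM (invmx P) p.
Proof.
move=> H; rewrite normM_invmx -(@ler_pXn2r _ 2) ?nnegrE ?sqrtr_ge0 // !sqr_normM.
have : dot p d = dot (invmx P *m p) (P *m d).
  by rewrite dot_symM mulKVmx ?posdef_unit // dotC.
have := posdef_ge0 (invmx P *m p - d).
rewrite mulmxDr mulmxN !dot_lin (dot_symM d); lra.
Qed.

End PositiveDefinite.

(** * Lower semicontinuity and minima over compact sets *)

Section LowerSemicontinuous.
Set Implicit Arguments.
Unset Strict Implicit.
Context {R : realType}.

Lemma ereal_lt_real_between (a b : \bar R) :
  (a < b)%E -> exists c : R, (a < c%:E < b)%E.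
Proof.
case: a b => [a| |] [b| |] //= ab.
- move: ab; rewrite lte_fin => ab.
  by exists ((a + b) / 2); rewrite !lte_fin; apply/andP; split; lra.
- by exists (a + 1); rewrite ltry lte_fin ltrDl ltr01.
- by exists (b - 1); rewrite ltNyr lte_fin ltrBlDr ltrDl ltr01.
- by exists 0; rewrite ltNyr ltry.
Qed.

Lemma lower_semicontinuousD_continuous (X : topologicalType) (h : X -> \bar R)
    (q : X -> R) :
  lower_semicontinuous h -> continuous q ->
  lower_semicontinuous (fun x => h x + (q x)%:E)%E.
Proof.
move=> h_lsc q_cont x a ahq.
(* Near [x], [h] stays above [s], and the slack [s + q x - a] absorbs the variation of [q]. *)
have [s /andP[ash sh]] : exists s : R, ((a - q x)%R%:E < s%:E < h x)%E.
  apply: ereal_lt_real_between; move: ahq; case: (h x) => [r| |] //=; rewrite ?ltry //.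
  by rewrite -EFinD !lte_fin ltrBlDr.
move: ash; rewrite lte_fin ltrBlDr => ash.
have [V Vx Vh] := h_lsc x s sh.
have e0 : 0 < s + q x - a by rewrite subr_gt0.
have /cvgrPdist_lt /(_ _ e0) qx := q_cont x.
exists (V `&` [set y | `|q x - q y| < s + q x - a]); first exact: filterI.
move=> y [/Vh hy /=]; rewrite ltr_norml => /andP[_ qy].
have : ((s + q y)%:E < h y + (q y)%:E)%E by rewrite EFinD lteD2rE.
by apply: lt_trans; rewrite lte_fin; lra.
Qed.

(** Were the infimum not attained, each point of [K] would have a neighbourhood where [h] exceeds
    some real level above the infimum. Let the levels decrease along the filter [F]: compactness
    yields one level that works on all of [K], contradicting the infimum. *)
Lemma lower_semicontinuous_compact_min (X : topologicalType) (K : set X)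
    (h : X -> \bar R) :
  compact K -> K !=set0 -> lower_semicontinuous h ->
  exists2 x, K x & forall z, K z -> (h x <= h z)%E.
Proof.
move=> K_cpt [x0 Kx0] h_lsc; apply: contrapT => no_min.
have I_lt x : K x -> (ereal_inf (h @` K) < h x)%E.
  move=> Kx; apply: contrapT => /negP; rewrite -leNgt => xI; apply: no_min.
  exists x => // z Kz; apply: le_trans xI _; apply: ereal_inf_lbound.
  by exists z.
pose D := [set a : R | (ereal_inf (h @` K) < a%:E)%E].
pose F := filter_from D (fun a => [set c | D c /\ c <= a]).
have FF : Filter F.
  apply: filter_from_filter.
    have [a /andP[Ia _]] := ereal_lt_real_between (I_lt x0 Kx0).
    by exists a.
  move=> a b Da Db; exists (Num.min a b).
    by rewrite /D /=; case: (Order.TotalTheory.leP a b).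
  by move=> c [Dc]; rewrite le_min => /andP[ca cb].
have /compact_near_coveringP/(_ R F (fun c x => c%:E < h x)%E FF) := K_cpt.
case.
  move=> x Kx; have [a /andP[Ia ahx]] := ereal_lt_real_between (I_lt x Kx).
  have [V Vx Vh] := h_lsc x a ahx.
  exists (V, [set c | D c /\ c <= a]) => /=; first by split => //; exists a.
  by move=> [y c] /= [/Vh hy [_ ca]]; apply: le_lt_trans hy; rewrite lee_fin.
move=> a Da /(_ a (conj Da (lexx a))) ah.
suff : (a%:E <= ereal_inf (h @` K))%E by rewrite leNgt Da.
by apply/ereal_infP => _ [x Kx <-]; apply/ltW/ah.
Qed.

Definition box n (c : 'cV[R]_n) (r : R) : set 'cV[R]_n :=
  [set x | forall i, `|x i 0 - c i 0| <= r].

Lemma compact_box n (c : 'cV[R]_n) r : compact (box c r).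
Proof.
(* A product of segments is compact as a set of row vectors; transposition carries it to columns. *)
have -> : box c r = trmx @` [set u : 'rV[R]_n |
    forall i, `[c i 0 - r, c i 0 + r]%classic (u ord0 i)].
  apply/seteqP; split => [x xc|_ [u uc <-] i].
    exists x^T; last by rewrite trmxK.
    by move=> i /=; rewrite mxE in_itv /= -ler_distl.
  by have := uc i; rewrite /= in_itv /= -ler_distl mxE.
apply: continuous_compact.
  apply: continuous_subspaceT => u B [Q Qu QB].
  exists (fun i j => Q j i) => [i j|v Qv]; first by have := Qu j i; rewrite mxE.
  by apply: QB => i j; rewrite mxE.
exact: (@rV_compact _ _ (fun i => `[c i 0 - r, c i 0 + r]%classic)
  (fun i => @segment_compact _ _ _)).
Qed.

Lemma le_norm2_box n (c x : 'cV[R]_n) r : norm2 (x - c) <= r -> box c r x.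
Proof.
move=> xr i; apply: le_trans xr.
rewrite -(@ler_pXn2r _ 2) ?nnegrE ?norm2_ge0 // sqr_norm2 real_normK ?num_real //.
rewrite dotE (bigD1 i) //= !mxE -expr2 lerDl sumr_ge0 // => k _.
by rewrite -expr2 sqr_ge0.
Qed.

Lemma continuous_sqr_norm2B n (q : 'cV[R]_n) (a : R) :
  continuous (fun x : 'cV[R]_n => a * norm2 (x - q) ^+ 2).
Proof.
have -> : (fun x : 'cV[R]_n => a * norm2 (x - q) ^+ 2) =
    (fun x => a * \sum_i (x i 0 - q i 0) * (x i 0 - q i 0)).
  apply/funext => x; rewrite sqr_norm2 dotE; congr (_ * _).
  by apply: eq_bigr => i _; rewrite !mxE.
move=> x; apply: continuousM; first exact: cst_continuous.
move: x; apply: continuous_big => [|i _ x].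
  by move=> p; apply: cvgD; [exact: cvg_fst|exact: cvg_snd].
pose d := fun x : 'cV[R]_n => x i 0 - q i 0.
by apply: (@continuousM R 'cV[R]_n d d); apply: continuousB;
  try exact: coord_continuous; exact: cst_continuous.
Qed.

End LowerSemicontinuous.

(** * Subdifferentials, conjugates and proximal points *)

Section ConvexAnalysis.
Set Implicit Arguments.
Unset Strict Implicit.
Context {R : realType}.

Lemma proper_efun_fin n (h : 'cV[R]_n -> \bar R) :
  proper_efun h -> exists x r, h x = r%:E.
Proof.
by move=> [hN [x]]; have := hN x; case E: (h x) => [r| |] //; exists x, r.
Qed.

Lemma subdiff_fin n (h : 'cV[R]_n -> \bar R) x u :
  proper_efun h -> subdiff h x u -> exists r, h x = r%:E.
Proof.
move=> hp hu; have [z [s hz]] := proper_efun_fin hp.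
have := hu z; rewrite hz; have := proj1 hp x.
by case: (h x) => [r| |] //; exists r.
Qed.

Lemma subdiff_monotone n (h : 'cV[R]_n -> \bar R) x x' u u' :
  proper_efun h -> subdiff h x u -> subdiff h x' u' ->
  0 <= dot (u - u') (x - x').
Proof.
move=> hp hu hu'; have [r hx] := subdiff_fin hp hu.
have [r' hx'] := subdiff_fin hp hu'.
have := hu x'; have := hu' x; rewrite hx hx' -!EFinD !lee_fin !dot_lin.
lra.
Qed.

(** Equality case of Fenchel-Young: the subgradient inequality says that the supremum defining
    [conjugate h u] is attained at [x]. *)
Lemma subdiff_Fenchel_eq n (h : 'cV[R]_n -> \bar R) x u r :
  proper_efun h -> subdiff h x u -> h x = r%:E ->
  conjugate h u = (dot u x - r)%:E.
Proof.
move=> hp hu hx; apply/eqP; rewrite eq_le; apply/andP; split; last first.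
  by apply: ereal_sup_ubound; exists x => //; rewrite hx.
apply/ereal_supP => _ [t _ <-]; have := hu t; rewrite hx.
have := proj1 hp t; case: (h t) => [s| |] // _; last by rewrite addeNy leNye.
by rewrite -!EFinD !lee_fin !dot_lin; lra.
Qed.

Lemma subdiff_conjugate n (h : 'cV[R]_n -> \bar R) x u :
  proper_efun h -> subdiff h x u -> subdiff (conjugate h) u x.
Proof.
move=> hp hu z; have [r hx] := subdiff_fin hp hu.
rewrite (subdiff_Fenchel_eq hp hu hx).
apply: ereal_sup_ubound; exists x => //.
by rewrite hx -!EFinD !dot_lin (dotC x z) (dotC x u); congr EFin; lra.
Qed.

Lemma convex_conjugate n (h : 'cV[R]_n -> \bar R) :
  (forall x, h x != -oo%E) -> convex_efun (conjugate h).
Proof.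
move=> hN x y t /andP[t0 t1]; apply/ereal_supP => _ [z _ <-].
have := hN z; case E: (h z) => [r| |] // _; last by rewrite addeNy leNye.
have le_conj w : ((dot w z - r)%:E <= conjugate h w)%E.
  by apply: ereal_sup_ubound; exists z => //; rewrite E.
have -> : ((dot (t *: x + (1 - t) *: y) z)%:E - r%:E =
    t%:E * (dot x z - r)%:E + (1 - t)%:E * (dot y z - r)%:E)%E.
  by rewrite -!EFinM -!EFinD !dot_lin; congr EFin; ring.
by apply: leeD; apply: lee_wpmul2l; rewrite ?lee_fin ?subr_ge0.
Qed.

(* Comparing [x] with [x + t (z - x)] and dividing by [t] leaves an error term
   [mu / 2 * t * |z - x|^2], which vanishes as [t] tends to 0. *)
Lemma argmin_quad_subdiff n (h : 'cV[R]_n -> \bar R) (c q x : 'cV[R]_n) (mu : R) :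
  proper_efun h -> convex_efun h ->
  argmin (fun z => h z - (dot z c)%:E + (mu / 2 * norm2 (z - q) ^+ 2)%:E)%E x ->
  subdiff h x (c - mu *: (x - q)).
Proof.
move=> hp h_cvx x_min z.
have hxN := proj1 hp x.
have [r hx] : exists r, h x = r%:E.
  have [z0 [s hz0]] := proper_efun_fin hp.
  by have := x_min z0; rewrite hz0; case: (h x) hxN => [r| |] //; exists r.
have hzN := proj1 hp z.
case hz: (h z) hzN => [s| |] // _; last by rewrite leey.
rewrite hx -EFinD lee_fin.
pose C := dot (z - x) (z - x).
have step t : 0 < t <= 1 ->
    r + dot (c - mu *: (x - q)) (z - x) <= s + mu / 2 * t * C.
  move=> /andP[t0 t1]; have := h_cvx z x t; rewrite ltW //= => /(_ t1).
  rewrite hx hz -!EFinM -EFinD => Hc.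
  have := x_min (t *: z + (1 - t) *: x).
  have zN := proj1 hp (t *: z + (1 - t) *: x).
  case: (h _) zN Hc => [p| |] // _; rewrite !lee_fin => Hp.
  rewrite hx -!EFinD !lee_fin !sqr_norm2 /C !dot_lin => Hm.
  rewrite -(ler_pM2l t0).
  by move: Hm; rewrite !(dotC x z) !(dotC q _) !(dotC c _) => Hm; nra.
apply/ler_addgt0Pr => e e0.
have C0 : 0 <= C := dotuu_ge0 _.
(* The summand [1] keeps [D] positive, so that [t] can be taken at most [e / D]; then the error term
   is at most [t * D <= e]. *)
pose D := 1 + `|mu| / 2 * C.
have D1 : 1 <= D by rewrite lerDl !mulr_ge0 // invr_ge0.
have De : 0 < e / D by rewrite divr_gt0 // (lt_le_trans ltr01).
pose t := Num.min 1 (e / D).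
have t0 : 0 < t by rewrite lt_min ltr01.
have t1 : t <= 1 by rewrite ge_min lexx.
apply: le_trans (step t _) _; first by rewrite t0.
rewrite lerD2l.
have teD : t * D <= e by rewrite -ler_pdivlMr ?(lt_le_trans ltr01) // ge_min lexx orbT.
apply: le_trans teD; rewrite mulrAC mulrC ler_wpM2l ?(ltW t0) // /D.
have := ler_norm mu; nra.
Qed.

(* Outside the unit ball around [x0], convexity along the segment from [x0] to
   [x] bounds [h x] from below by the minimum of [h] on a box containing it. *)
Lemma convex_lsc_linear_lb n (h : 'cV[R]_n -> \bar R) (x0 : 'cV[R]_n) :
  convex_efun h -> lower_semicontinuous h -> (forall x, h x != -oo%E) ->
  h x0 != +oo%E ->
  exists a b : R, 0 <= b /\ forall x, ((a - b * norm2 (x - x0))%:E <= h x)%E.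
Proof.
move=> h_cvx h_lsc hN h0.
have box0 : box x0 1 x0 by apply: le_norm2_box; rewrite subrr norm20.
have [xm _ xm_min] : exists2 x, box x0 1 x & forall z, box x0 1 z -> (h x <= h z)%E.
  by apply: lower_semicontinuous_compact_min => //; [exact: compact_box|exists x0].
have := xm_min x0 box0; have := hN xm; have := hN x0.
case E0: (h x0) h0 => [H| |] // _ _.
case Em: (h xm) xm_min => [M| |] // xm_min _; rewrite lee_fin => MH.
exists M, (H - M); split => [|x]; first by rewrite subr_ge0.
have [s1|s1] := Order.TotalTheory.leP (norm2 (x - x0)) 1.
  apply: le_trans (xm_min x (le_norm2_box s1)).
  by rewrite lee_fin lerBlDr lerDl mulr_ge0 ?subr_ge0 // norm2_ge0.
have s0 : 0 < norm2 (x - x0) := lt_trans ltr01 s1.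
set t := (norm2 (x - x0))^-1.
have t0 : 0 < t by rewrite invr_gt0.
have t1 : t <= 1 by rewrite invf_le1 // ltW.
have zb : box x0 1 (t *: x + (1 - t) *: x0).
  apply: le_norm2_box; have -> : t *: x + (1 - t) *: x0 - x0 = t *: (x - x0).
    by apply/colP => i; rewrite !mxE; ring.
  by rewrite norm2Z gtr0_norm // mulVf // gt_eqF.
have := le_trans (xm_min _ zb) (h_cvx x x0 t _); rewrite ltW //= => /(_ t1).
rewrite E0; have := hN x; case: (h x) => [p| |] //; last by rewrite leey.
move=> _; rewrite -!EFinM -EFinD !lee_fin => Hp.
rewrite -(ler_pM2l t0) mulrBr mulrCA mulVf ?gt_eqF // mulr1; nra.
Qed.

(** The quadratic outgrows the linear lower bound on [h], so a minimum over a large box is global.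
    The term [dot z 0] gives the objective the shape that [argmin_quad_subdiff] expects. *)
Lemma prox_exists n (h : 'cV[R]_n -> \bar R) (q : 'cV[R]_n) (mu : R) :
  0 < mu -> proper_efun h -> convex_efun h -> lower_semicontinuous h ->
  exists x, argmin (fun z => h z - (dot z 0)%:E + (mu / 2 * norm2 (z - q) ^+ 2)%:E)%E x.
Proof.
move=> mu0 hp h_cvx h_lsc; have [x0 [H h0]] := proper_efun_fin hp.
have [|a [b [b0 lb]]] := @convex_lsc_linear_lb n h x0 h_cvx h_lsc (proj1 hp).
  by rewrite h0.
pose phi z := (h z + (mu / 2 * norm2 (z - q) ^+ 2)%:E)%E.
(* At distance [s] from [x0], [z] is no better than [x0] once [B <= mu / 4 * s ^+ 2 - b * s]. If [s]
   exceeds [r], the right side is at least [s], hence at least [B]. *)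
pose B := H + mu / 2 * dot (x0 - q) (x0 - q) - a + mu / 2 * dot (x0 - q) (x0 - q).
pose r := 4 * (b + 1) / mu + `|B|.
have r0 : 0 <= r by rewrite addr_ge0 // divr_ge0 ?(ltW mu0) // mulr_ge0 // addr_ge0.
have phi_lsc : lower_semicontinuous phi.
  by apply: lower_semicontinuousD_continuous => //; exact: continuous_sqr_norm2B.
have box0 : box x0 r x0 by apply: le_norm2_box; rewrite subrr norm20.
have [x _ x_min] : exists2 x, box x0 r x & forall z, box x0 r z -> (phi x <= phi z)%E.
  by apply: lower_semicontinuous_compact_min => //; [exact: compact_box|exists x0].
exists x => z; rewrite !dot0r !sube0 -!/(phi _).
have [/le_norm2_box/x_min//|zr] := Order.TotalTheory.leP (norm2 (z - x0)) r.
apply: le_trans (x_min _ box0) _; rewrite /phi h0.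
apply: le_trans (leeD (lb z) (lexx _)).
rewrite -!EFinD lee_fin !sqr_norm2.
set s := norm2 (z - x0) in zr *.
have s_sq : s ^+ 2 = dot (z - x0) (z - x0) := sqr_norm2 _.
(* Parallelogram law for [z - q] and [x0 - q], whose difference is [z - x0]. *)
have par : s ^+ 2 / 2 - dot (x0 - q) (x0 - q) <= dot (z - q) (z - q).
  have := dotuu_ge0 ((z - q) + (x0 - q)).
  rewrite s_sq !dot_lin !(dotC x0 z) !(dotC q _); lra.
have s0 : 0 <= s := norm2_ge0 _.
have sb : 4 * (b + 1) / mu <= s.
  by apply: le_trans (ltW zr); rewrite lerDl.
have sB : B <= s.
  apply: le_trans (ltW zr); apply: le_trans (ler_norm B) _.
  by rewrite lerDr divr_ge0 ?(ltW mu0) // mulr_ge0 // addr_ge0.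
move: sb; rewrite ler_pdivrMr // => sb.
suff : B <= mu / 4 * s ^+ 2 - b * s.
  rewrite /B => HB; have := ler_wpM2l (ltW mu0) par; lra.
apply: le_trans sB _; nra.
Qed.

Lemma proper_conjugate n (h : 'cV[R]_n -> \bar R) :
  proper_efun h -> convex_efun h -> lower_semicontinuous h ->
  proper_efun (conjugate h).
Proof.
move=> hp h_cvx h_lsc; split => [y|].
  have [x [r hx]] := proper_efun_fin hp; rewrite -ltNye.
  apply: (@lt_le_trans _ _ (dot y x - r)%:E); first exact: ltNyr.
  by apply: ereal_sup_ubound; exists x => //; rewrite hx.
(* A subgradient at a proximal point gives an affine minorant of [h]. *)
have [x /(argmin_quad_subdiff hp h_cvx)] := prox_exists 0 ltr01 hp h_cvx h_lsc.
set u := _ - _ => hu; have [r hx] := subdiff_fin hp hu.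
by exists u; rewrite (subdiff_Fenchel_eq hp hu hx).
Qed.

End ConvexAnalysis.

(** * The proximal point method for a monotone operator in the metric of [P] *)

Section ProximalPoint.
Set Implicit Arguments.
Unset Strict Implicit.
Context {R : realType} {n : nat} (P : 'M[R]_n).
Hypothesis P_sym : P^T = P.
Hypothesis P_pos : forall u, u != 0 -> 0 < dot u (P *m u).
Variables (F : 'cV[R]_n -> set 'cV[R]_n) (z : nat -> 'cV[R]_n).
Hypothesis F_monotone : forall x x' p p',
  F x p -> F x' p' -> 0 <= dot (p - p') (x - x').
Hypothesis z_step : forall k, F (z k.+1) (P *m (z k - z k.+1)).

Local Notation res k := (distM (invmx P) 0 (F (z k))).

Lemma normM_ge0 M (u : 'cV[R]_n) : 0 <= normM M u.
Proof. exact: sqrtr_ge0. Qed.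

Lemma normMN M (u : 'cV[R]_n) : normM M (- u) = normM M u.
Proof. by rewrite /normM mulmxN [(- u)^T]linearN /= !mulNmx opprK. Qed.

Lemma distM_ge0 M x (S : set 'cV[R]_n) : (0 <= distM M x S)%E.
Proof. by apply/ereal_infP => _ [u _ <-]; rewrite lee_fin normM_ge0. Qed.

Lemma residual_le_step k : (res k.+1 <= (normM P (z k - z k.+1))%:E)%E.
Proof.
apply: ereal_inf_lbound; exists (P *m (z k - z k.+1)) => //.
by rewrite subr0 (normM_invmx P_sym P_pos) mulKmx // (posdef_unit P_sym P_pos).
Qed.

(** For [d = z k - z k.+1] and any [p] in [F (z k)], monotonicity against [z_step k] gives
    [dot d (P *m d) <= dot p d], the premise of [normM_invmx_ge]. *)
Lemma step_le_residual k : ((normM P (z k - z k.+1))%:E <= res k)%E.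
Proof.
apply/ereal_infP => _ [p Fp <-]; rewrite lee_fin subr0.
apply: (normM_invmx_ge P_sym P_pos).
have := F_monotone Fp (z_step k).
by rewrite dotDl dotNl subr_ge0 (dotC (P *m _)).
Qed.

Lemma step_nonincreasing k :
  normM P (z k.+1 - z k.+2) <= normM P (z k - z k.+1).
Proof.
by rewrite -lee_fin; apply: le_trans (step_le_residual _) (residual_le_step _).
Qed.

Lemma residual_nonincreasing i k : (res (i + k) <= res i)%E.
Proof.
elim: k => [|k IH]; first by rewrite addn0.
rewrite addnS; apply: le_trans IH.
exact: le_trans (residual_le_step _) (step_le_residual _).
Qed.

Lemma step_descent k zs : F zs 0 ->
  normM P (z k.+1 - zs) ^+ 2 + normM P (z k - z k.+1) ^+ 2 <=
  normM P (z k - zs) ^+ 2.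
Proof.
move=> Fzs; have := F_monotone (z_step k) Fzs; rewrite subr0 dotC => H.
have -> : z k - zs = (z k.+1 - zs) + (z k - z k.+1).
  by apply/colP => i; rewrite !mxE; ring.
move: (z k.+1 - zs) (z k - z k.+1) H => a d H.
rewrite !(sqr_normM P_pos) mulmxDr !dotDl !dotDr (dot_symM P_sym d a); lra.
Qed.

(** Telescoping [step_descent]: each of the [k.+1] steps from [i] is at least as long as the last.
    The free start [i] lets [residual_contraction] restart the estimate at any iterate. *)
Lemma steps_descent i k zs : F zs 0 ->
  normM P (z (i + k.+1)%N - zs) ^+ 2 +
    k.+1%:R * normM P (z (i + k)%N - z (i + k).+1) ^+ 2 <=
  normM P (z i - zs) ^+ 2.
Proof.
move=> Fzs; elim: k => [|k IH]; first by rewrite addn1 addn0 mul1r step_descent.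
apply: le_trans IH.
have := step_descent (i + k.+1) Fzs; have := step_nonincreasing (i + k).
rewrite -!addnS -(@ler_pXn2r _ 2) ?nnegrE ?normM_ge0 // => H1 H2.
rewrite [k.+2%:R]mulrS mulrDl mul1r addrA lerD //.
by rewrite ler_wpM2l.
Qed.

Lemma residual_rate i k zs : (0 < k)%N -> F zs 0 ->
  (res (i + k) ^+ 2 <= (k%:R^-1 * normM P (z i - zs) ^+ 2)%:E)%E.
Proof.
case: k => // k _ Fzs; rewrite addnS.
apply: (@le_trans _ _ ((normM P (z (i + k)%N - z (i + k).+1))%:E ^+ 2)%E).
  by rewrite lee_sqr ?distM_ge0 ?lee_fin ?normM_ge0 // residual_le_step.
rewrite -EFin_expe lee_fin ler_pdivlMl ?ltr0n //.
by apply: le_trans (steps_descent i k Fzs); rewrite lerDr sqr_ge0.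
Qed.

Lemma residual_contraction alpha K i zs : 0 < alpha -> F zs 0 ->
  expR 1 / alpha ^+ 2 <= K%:R ->
  (alpha%:E * distM P (z i) [set x | F x 0%R] <= res i)%E ->
  (res (i + K) ^+ 2 <= (expR (-1))%:E * res i ^+ 2)%E.
Proof.
move=> a0 Fzs; rewrite ler_pdivrMr ?exprn_gt0 // => HK reg.
have K0 : (0 < K)%N.
  by rewrite lt0n; apply: contraTneq HK => ->; rewrite mul0r -ltNge expR_gt0.
have Kr : 0 < K%:R :> R by rewrite ltr0n.
have := residual_rate i K0 Fzs.
have := distM_ge0 (invmx P) 0 (F (z (i + K)%N)).
case Eq: (res (i + K)) => [q| |] //; rewrite lee_fin => q0.
rewrite -EFin_expe lee_fin => _.
have := distM_ge0 (invmx P) 0 (F (z i)).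
(* If [F (z i)] is empty, [res i] is [+oo] and so is the right-hand side. *)
case Ed: (res i) reg => [d| |] //; rewrite ?lee_fin => reg d0; last first.
  by rewrite expe2 gt0_muley ?gt0_muley ?leey // lte_fin expR_gt0.
rewrite -expr2 expRN mulrC ler_pdivlMr ?expR_gt0 //.
have sK : 0 < Num.sqrt K%:R :> R by rewrite sqrtr_gt0.
(* [residual_rate] holds for every zero [x], so the infimum over [x] can be taken. With [reg] and
   squaring this gives [alpha ^+ 2 * K%:R * q ^+ 2 <= d ^+ 2], where [HK] bounds the factor below by
   [expR 1]. *)
have : ((Num.sqrt K%:R * q)%:E <= distM P (z i) [set x | F x 0%R])%E.
  apply/ereal_infP => _ [x Fx <-]; rewrite lee_fin -normMN opprB.
  rewrite -(@ler_pXn2r _ 2) ?nnegrE ?normM_ge0 ?mulr_ge0 ?sqrtr_ge0 //.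
  rewrite exprMn sqr_sqrtr ?ler0n //.
  have := residual_rate i K0 Fx; rewrite Eq -EFin_expe lee_fin.
  by rewrite ler_pdivlMl.
move=> H; have := le_trans (lee_wpmul2l _ H) reg; rewrite lee_fin ltW // => /(_ isT).
rewrite -EFinM lee_fin -(@ler_pXn2r _ 2) ?nnegrE ?mulr_ge0 ?sqrtr_ge0 ?(ltW a0) //.
rewrite !exprMn sqr_sqrtr ?ler0n // => H2; apply: le_trans H2.
by have := ler_wpM2r (sqr_ge0 q) HK; lra.
Qed.

Lemma residual_linear_rate alpha K zs k : 0 < alpha -> F zs 0 ->
  expR 1 / alpha ^+ 2 <= K%:R ->
  (forall i, (alpha%:E * distM P (z i) [set x | F x 0%R] <= res i)%E) ->
  (res k ^+ 2 <= (expR (1 - k%:R / K%:R))%:E * res 0%N ^+ 2)%E.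
Proof.
move=> a0 Fzs HK reg.
have K0 : (0 < K)%N.
  rewrite lt0n; apply: contraTneq HK => ->.
  by rewrite -ltNge divr_gt0 ?expR_gt0 ?exprn_gt0.
have blocks j : (res (j * K) ^+ 2 <= (expR (- j%:R))%:E * res 0%N ^+ 2)%E.
  elim: j => [|j IH]; first by rewrite oppr0 expR0 mul1e.
  rewrite mulSnr; apply: le_trans (residual_contraction a0 Fzs HK (reg _)) _.
  by rewrite mulrS opprD expRD EFinM -muleA lee_wpmul2l.
(* Monotonicity discards the last [k %% K] steps; rounding [k / K] down costs less than one block,
   whence the [1] in the exponent. *)
apply: (@le_trans _ _ (res (k %/ K * K) ^+ 2)%E).
  rewrite {1}(divn_eq k K) lee_sqr ?distM_ge0 //.
  exact: residual_nonincreasing.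
apply: le_trans (blocks _) _; rewrite lee_wpmul2r ?sqre_ge0 // lee_fin ler_expR.
suff : k%:R / K%:R <= (k %/ K).+1%:R :> R by rewrite -natr1; lra.
by rewrite ler_pdivrMr ?ltr0n // -natrM ler_nat ltnW // ltn_ceil.
Qed.

End ProximalPoint.

(** * Linearized ADMM as a proximal point iteration *)

Section LinearizedADMM.
Set Implicit Arguments.
Unset Strict Implicit.
Context {R : realType} {m n : nat}.
Variables (f : 'cV[R]_n -> \bar R) (g : 'cV[R]_m -> \bar R) (A : 'M[R]_(m, n)).

(** The coupling through [A^T] and [- A] is skew, so its two contributions cancel and only the two
    subdifferentials remain. *)
Lemma KKT_monotone x x' y y' p p' :
  proper_efun f -> proper_efun (conjugate g) ->
  KKT f g A x y p -> KKT f g A x' y' p' ->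
  0 <= dot (p - p') (col_mx x y - col_mx x' y').
Proof.
move=> fp gp [a fa [b gb <-]] [a' fa' [b' gb' <-]].
have := subdiff_monotone fp fa fa'; have := subdiff_monotone gp gb gb'.
rewrite !opp_col_mx !add_col_mx dot_col_mx.
have -> : a + A^T *m y - (a' + A^T *m y') = (a - a') + A^T *m (y - y').
  rewrite mulmxBr; move: (_ *m _) (_ *m _) => c c'.
  by apply/colP => i; rewrite !mxE; ring.
have -> : b - A *m x - (b' - A *m x') = (b - b') - A *m (x - x').
  rewrite mulmxBr; move: (_ *m _) (_ *m _) => c c'.
  by apply/colP => i; rewrite !mxE; ring.
rewrite !(dotDl (_ - _)) dotNl dot_mulmxl trmxK (dot_mulmxl A).
rewrite (dotC (y - y') (A *m _)) dot_mulmxl; lra.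
Qed.

Lemma linearized_ADMM_step (tau lambda : R) v w y k :
  proper_efun f -> convex_efun f -> lower_semicontinuous f ->
  proper_efun g -> convex_efun g -> lower_semicontinuous g -> 0 < tau ->
  linearized_ADMM f g A tau lambda v w y ->
  KKT f g A (v k.+1) (y k.+1)
    (Pmx A tau lambda *m (col_mx (v k) (y k) - col_mx (v k.+1) (y k.+1))).
Proof.
move=> fp fc fl gp gc gl tau0 /(_ k) [w_min v_eq y_min].
have fsp := proper_conjugate fp fc fl.
have gsp := proper_conjugate gp gc gl.
have v_sub : subdiff (conjugate f) (w k.+1) (v k.+1).
  have := argmin_quad_subdiff fsp (convex_conjugate (proj1 fp)) w_min.
  congr (subdiff _ _ _); rewrite v_eq.
  by apply/colP => i; rewrite !mxE; ring.
(* Instead of the biconjugation theorem: the proximal point of [f] at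
   [v k.+1 + tau w k.+1] satisfies the same inclusion for the monotone operator
   [subdiff (conjugate f)], hence is [v k.+1]. *)
have w_sub : subdiff f (v k.+1) (w k.+1).
  pose q := v k.+1 + tau *: w k.+1.
  have ti : 0 < tau^-1 by rewrite invr_gt0.
  have [x /(argmin_quad_subdiff fp fc)] := prox_exists q ti fp fc fl.
  set u := _ - _ => fu.
  have qE : q = x + tau *: u.
    by apply/colP => i; rewrite !mxE; field; rewrite gt_eqF.
  have := subdiff_monotone fsp (subdiff_conjugate fp fu) v_sub.
  (* Both [x + tau *: u] and [v k.+1 + tau *: w k.+1] equal [q], so monotonicity bounds [- tau]
     times the square of [u - w k.+1] below by zero. *)
  have -> : x - v k.+1 = - (tau *: (u - w k.+1)).
    rewrite scalerBr opprB; apply/eqP; rewrite subr_eq addrAC eq_sym subr_eq.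
    by rewrite -qE /q addrC.
  rewrite dotNl dotZl oppr_ge0 pmulr_rle0 // => uw.
  have /eqP : u - w k.+1 = 0.
    by apply: dotuu_eq0; apply/eqP; rewrite eq_le uw dotuu_ge0.
  rewrite subr_eq0 => /eqP uw_eq.
  have xv : x = v k.+1 by move: qE; rewrite uw_eq => /addIr.
  by rewrite -uw_eq -xv.
have y_sub : subdiff (conjugate g) (y k.+1)
    (A *m (v k.+1 - tau *: (A^T *m y k + w k.+1)) - lambda *: (y k.+1 - y k)).
  apply: (argmin_quad_subdiff gsp (convex_conjugate (proj1 gp))).
  move=> z; have := y_min z.
  by rewrite !dot_mulmxl trmxK.
exists (w k.+1) => //.
eexists; first exact: y_sub.
(* This turns the point multiplied by [A] in [y_sub] into the extrapolation
   [v k.+1 - (v k - v k.+1)], and makes the off-diagonal blocks of [Pmx] match. *)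
have vB : v k - v k.+1 = tau *: (A^T *m y k + w k.+1).
  by rewrite {1}v_eq opprB addrCA subrr addr0.
rewrite -vB opp_col_mx add_col_mx /Pmx mul_block_col !mul_scalar_mx !mulNmx !mulmxBr.
congr col_mx.
  rewrite vB scalerA mulVf ?gt_eqF // scale1r.
  move: (A^T *m _) (A^T *m _) => a b.
  by apply/colP => i; rewrite !mxE; ring.
move: (A *m _) (A *m _) => a b.
by apply/colP => i; rewrite !mxE; ring.
Qed.

End LinearizedADMM.

(** * The three residual estimates for the stacked iterates [col_mx (v k) (y k)] *)

Theorem theorem6 (R : realType) (m n : nat)
    (f : 'cV[R]_n -> \bar R) (g : 'cV[R]_m -> \bar R) (A : 'M[R]_(m, n))
    (f_proper : proper_efun f) (f_lsc : lower_semicontinuous f)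
    (f_convex : convex_efun f)
    (g_proper : proper_efun g) (g_lsc : lower_semicontinuous g)
    (g_convex : convex_efun g)
    (vs : 'cV[R]_n) (ys : 'cV[R]_m)
    (vs_ys_opt : KKT_zeros f g A (col_mx vs ys))
    (tau lambda : R) (tau_gt0 : 0 < tau)
    (lambda_gt : tau * opnorm A ^+ 2 < lambda)
    (v w : nat -> 'cV[R]_n) (y : nat -> 'cV[R]_m)
    (vwy_iter : linearized_ADMM f g A tau lambda v w y) :
  let P := Pmx A tau lambda in
  let dist2 k := (distM (invmx P) 0%R (KKT f g A (v k) (y k)) ^+ 2)%E in
  [/\ forall k : nat, (1 <= k)%N -> (dist2 k.+1 <= dist2 k)%E,
      forall k : nat, (1 <= k)%N ->
        (dist2 k <=
          (k%:R^-1 * normM P (col_mx (v 0%N) (y 0%N) - col_mx vs ys) ^+ 2)%R%:E)%E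
    & forall (alpha : R) (SS : set 'cV[R]_(n + m)),
        0 < alpha ->
        (forall k : nat, SS (col_mx (v k) (y k))) ->
        (forall (v' : 'cV[R]_n) (y' : 'cV[R]_m), SS (col_mx v' y') ->
          (alpha%:E * distM P (col_mx v' y') (KKT_zeros f g A)
            <= distM (invmx P) 0%R (KKT f g A v' y'))%E) ->
        forall k : nat,
          let K : int := Num.ceil (expR 1 / alpha ^+ 2) in
          K <= k%:Z ->
          (dist2 k <= (expR (1 - k%:R / K%:~R))%R%:E * dist2 0%N)%E].
Proof.
move=> P dist2.
have P_pos u := @Pmx_posdef R m n A tau lambda u tau_gt0 lambda_gt.
have P_sym := Pmx_sym A tau lambda.
pose F (z : 'cV[R]_(n + m)) := KKT f g A (usubmx z) (dsubmx z).
pose z k := col_mx (v k) (y k).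
have Fz k : KKT f g A (v k) (y k) = F (z k) by rewrite /F col_mxKu col_mxKd.
have F_mono x x' p p' : F x p -> F x' p' -> 0 <= dot (p - p') (x - x').
  rewrite -{2}(vsubmxK x) -{2}(vsubmxK x').
  exact: KKT_monotone f_proper (proper_conjugate g_proper g_convex g_lsc).
have z_step k : F (z k.+1) (P *m (z k - z k.+1)).
  by rewrite -Fz; apply: linearized_ADMM_step vwy_iter.
have dist2E k : dist2 k = (distM (invmx P) 0%R (F (z k)) ^+ 2)%E.
  by rewrite /dist2 Fz.
split => [k _|k k0|alpha SS alpha0 SSz reg k K Kk].
- rewrite !dist2E lee_sqr ?distM_ge0 // -[k.+1]addn1.
  exact: (residual_nonincreasing P_sym P_pos F_mono z_step).
- rewrite dist2E -[k]add0n.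
  exact: (residual_rate P_sym P_pos F_mono z_step).
(* Positivity identifies the integer ceiling with the natural number that serves as block length. *)
- have K0 : 0 < K by rewrite ceil_gt0 divr_gt0 ?expR_gt0 ?exprn_gt0.
  have KE : K%:~R = `|K|%N%:R :> R by rewrite -{1}(gtz0_abs K0).
  rewrite !dist2E KE.
  apply: (residual_linear_rate P_sym P_pos F_mono z_step _ alpha0 vs_ys_opt).
    by rewrite -KE ceil_ge.
  by move=> i; rewrite -Fz; apply: reg.
Qed.
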